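(* Let $\mathcal T$ be a set of tile designs for the regular tetrahedron with symmetry group the full tetrahedral group $T_d$ (order $24$). Suppose there are $t_{\mathrm{id}}$ tiles, $t_f$ of which are fixed under (horizontal) reflection of the triangular face and $t_r$ of which are fixed under $120^\circ$ rotation of the face. Then the number of ways of tiling the faces of the tetrahedron up to full tetrahedral symmetry $T_d$ is $$\frac{1}{24}\left(t_{\mathrm{id}}^4+8\,t_{\mathrm{id}}t_r+3\,t_{\mathrm{id}}^2+6\,t_{\mathrm{id}}t_f^2+6\,t_{\mathrm{id}}\right).$$
   Context: Tilings. Let $P$ be a polyhedron with set of faces $\mathcal F$ and let $\mathcal A$ be a group of isometries of $P$, acting on $\mathcal F$. A set of tile designs is a finite set $\mathcal T$ together with a group action of $\mathcal A$ on $\mathcal T\times\mathcal F$ lying over the action on $\mathcal F$ (so $A\cdot(T,F)=(T',A\cdot F)$ for some $T'\in\mathcal T$). A tiling is a map $\tau:\mathcal F\to\mathcal T$; $\mathcal A$ acts on tilings by moving graphs: $A\cdot\tau$ is the tiling with $((A\cdot\tau)(A\cdot F),A\cdot F)=A\cdot(\tau(F),F)$ for all $F$. The number of ways of tiling up to $\mathcal A$ is the number of $\mathcal A$-orbits on the set of tilings. The induced symmetry group $G$ of a face $F$ is the group of isometries of $F$ realized by elements of the stabilizer $\mathcal A_F$; for $g\in G$, $t_g$ is the number of $T\in\mathcal T$ with $g\cdot(T,F)=(T,F)$, where $g$ acts via the element of $\mathcal A_F$ inducing it. Since $\mathcal A$ acts transitively on faces, $t_g$ does not depend on the choice of $F$.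 In particular $t_{\mathrm{id}}=|\mathcal T|$. Polyhedron and group. Here $\mathcal A=T_d$ is the group of order $24$ generated by the matrices $R_0=\begin{pmatrix}0&1&0\\1&0&0\\0&0&1\end{pmatrix}$, $R_1=\begin{pmatrix}1&0&0\\0&0&1\\0&1&0\end{pmatrix}$, $R_2=\begin{pmatrix}0&-1&0\\-1&0&0\\0&0&1\end{pmatrix}$. The tetrahedron is the convex hull of the $T_d$-orbit of $(1,1,1)$ ($4$ vertices, $4$ equilateral triangular faces). The induced symmetry group of a face is $D_3=\langle r,f\mid r^3=f^2=(rf)^2=e\rangle$, with $r$ a $120^\circ$ rotation and $f$ a reflection of the triangle. *)

(* Defs.v *)
From HB Require Import structures.
From mathcomp Require Import all_boot all_order all_algebra.
From mathcomp Require Import boolp classical_sets functions cardinality reals.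
From mathcomp Require Import convex trigo.

Set Implicit Arguments.
Unset Strict Implicit.
Unset Printing Implicit Defensive.

Import Order.TTheory GRing.Theory Num.Theory.

Local Open Scope classical_set_scope.
Local Open Scope ring_scope.

(* Points are column vectors, so that matrices act on them by left
   multiplication. *)
Notation point R := 'cV[R]_3.

Definition dot (R : realType) (x y : point R) : R := (x^T *m y) 0 0.

Definition move (R : realType) (A : 'M[R]_3) (X : set (point R)) :
  set (point R) := [set A *m x | x in X].

Definition convex_hull (R : realType) (X : set (point R)) : set (point R) :=
  smallest (@convex_set R (point R)) X.

(* The faces of a polyhedron are its two-dimensional ones: the intersections
   with a supporting plane that contain three affinely independent points. *)
Definition faces (R : realType) (P : set (point R)) : set (set (point R)) :=
  [set F | (exists (u : point R) (h : R),
              [/\ u != 0,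
                  forall x, P x -> dot u x <= h &
                  F = P `&` [set x | dot u x = h]]) /\
           (exists a b c : point R,
              [/\ F a, F b, F c & \rank (row_mx (b - a) (c - a)) = 2%N])].

Definition matrix_group (R : realType) (G : set 'M[R]_3) : Prop :=
  [/\ forall A, G A -> A \in unitmx,
      G 1%:M,
      forall A B, G A -> G B -> G (A *m B) &
      forall A, G A -> G (invmx A)].

Definition generated_group (R : realType) (S : set 'M[R]_3) : set 'M[R]_3 :=
  smallest (@matrix_group R) S.

(* A group action of [Grp] on designs * faces, lying over the action on faces.
   [tile_act] is total on matrices; only its values on [Grp] are meaningful. *)
Record tile_designs (R : realType) (P : set (point R)) (Grp : set 'M[R]_3) :=
  TileDesigns {
    design : finType;
    tile_act : 'M[R]_3 -> design * faces P -> design * faces P;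
    tile_act1 : forall x, tile_act 1%:M x = x;
    tile_actM : forall A B, Grp A -> Grp B ->
      forall x, tile_act (A *m B) x = tile_act A (tile_act B x);
    tile_act_over : forall A, Grp A ->
      forall T F, \val (tile_act A (T, F)).2 = move A (\val F) }.

Definition tiling (R : realType) (P : set (point R)) (Grp : set 'M[R]_3)
    (D : tile_designs P Grp) : Type := faces P -> design D.

Definition tiling_graph (R : realType) (P : set (point R))
    (Grp : set 'M[R]_3) (D : tile_designs P Grp) (tau : tiling D) :
  set (design D * faces P) := [set (tau F, F) | F in [set: faces P]].

Definition tiling_orbit (R : realType) (P : set (point R))
    (Grp : set 'M[R]_3) (D : tile_designs P Grp) (tau : tiling D) :
  set (tiling D) :=
  [set tau' | exists2 A, Grp A &
     tiling_graph tau' = [set tile_act A x | x in tiling_graph tau]].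

Definition tiling_orbits (R : realType) (P : set (point R))
    (Grp : set 'M[R]_3) (D : tile_designs P Grp) : set (set (tiling D)) :=
  range (@tiling_orbit R P Grp D).
Arguments tiling_orbits {R P Grp} D.

Definition stabilizer (R : realType) (Grp : set 'M[R]_3)
    (F : set (point R)) : set 'M[R]_3 :=
  [set A | Grp A /\ move A F = F].

Definition induces (R : realType) (F : set (point R)) (A : 'M[R]_3)
    (g : F -> F) : Prop :=
  forall x : F, \val (g x) = A *m \val x.

Definition induced_symmetry_group (R : realType) (Grp : set 'M[R]_3)
    (F : set (point R)) : set (F -> F) :=
  [set g | exists2 A, stabilizer Grp F A & induces A g].
Arguments induced_symmetry_group {R} Grp F.

(* The designs T with g . (T, F) = (T, F); their number is t_g.  When the plane
   of F misses the origin, the A inducing g is unique. *)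
Definition fixed_designs (R : realType) (P : set (point R))
    (Grp : set 'M[R]_3) (D : tile_designs P Grp) (F : faces P)
    (g : \val F -> \val F) : {set design D} :=
  [set T | `[< exists A, [/\ stabilizer Grp (\val F) A, induces A g &
                             tile_act A (T, F) = (T, F)] >]]%SET.

(* Rotation by theta about c in the plane c + <u, v>; swapping u and v reverses
   the sense of rotation, so both orientations are covered. *)
Definition is_rotation (R : realType) (theta : R) (F : set (point R))
    (g : F -> F) : Prop :=
  exists c u v : point R,
    [/\ dot u u = 1, dot v v = 1, dot u v = 0 &
        forall x : F, exists a b : R,
          \val x = c + a *: u + b *: v /\
          \val (g x) = c + (a * cos theta - b * sin theta) *: u
                         + (a * sin theta + b * cos theta) *: v].

(* Reflection in the plane through c orthogonal to n, moving some point of F.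
   As g maps F to itself, n is then parallel to the plane of F, so this is a
   reflection of that plane in a line. *)
Definition is_reflection (R : realType) (F : set (point R))
    (g : F -> F) : Prop :=
  (exists c n : point R,
     n != 0 /\
     forall x : F, \val (g x) =
       \val x - (2 * dot (\val x - c) n / dot n n) *: n) /\
  (exists x : F, g x <> x).

Definition mx3 (R : realType) (s : seq (seq R)) : 'M[R]_3 :=
  \matrix_(i < 3, j < 3) nth 0 (nth [::] s i) j.

Definition R0 (R : realType) : 'M[R]_3 :=
  mx3 [:: [:: 0; 1; 0]; [:: 1; 0; 0]; [:: 0; 0; 1]].
Definition R1 (R : realType) : 'M[R]_3 :=
  mx3 [:: [:: 1; 0; 0]; [:: 0; 0; 1]; [:: 0; 1; 0]].
Definition R2 (R : realType) : 'M[R]_3 :=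
  mx3 [:: [:: 0; -1; 0]; [:: -1; 0; 0]; [:: 0; 0; 1]].

Definition Td (R : realType) : set 'M[R]_3 :=
  generated_group [set R0 R; R1 R; R2 R].
Arguments Td R : clear implicits.

Definition tetrahedron (R : realType) : set (point R) :=
  convex_hull [set A *m (const_mx 1 : point R) | A in Td R].
Arguments tetrahedron R : clear implicits.

(* Main.v *)
Require Import Defs.
From mathcomp Require Import all_boot all_order all_fingroup all_algebra.
From mathcomp Require Import ring lra.
From mathcomp Require Import boolp classical_sets functions cardinality reals.
From mathcomp Require Import interval_inference convex trigo.

(** The formula is Burnside's lemma for the group of the tetrahedron acting on
    its tilings.

    The geometry serves to identify this action.  The four vertices [vertex i]
    are a tight frame of 3-space, so every permutation of them extends to a
    unique linear map, [perm_matrix s], and it turns out that the generators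
    R0, R1, R2 are the matrices of three transpositions.  Hence Td is the
    symmetric group on the vertices (lemma [TdE]).  Barycentric coordinates
    describe the tetrahedron by four inequalities ([tetrahedronE]) and show that
    its two-dimensional faces are exactly the four facets, each opposite to a
    vertex ([facesE]).  A tiling is thus a map from a set of four elements to
    the designs, and the group is the full symmetric group of this set.

    Burnside's lemma ([sum_fixed_tilings]) reduces the count of orbits to that
    of the tilings fixed by each permutation of the faces.  In a fixed tiling
    the designs along a cycle of faces are determined by one of them, which must
    itself be fixed by going once around the cycle.  So a cycle of length [n] of
    [s] contributes as many choices as there are designs fixed by the [n]-th
    power of [s]: all of them if that power is the identity, and t_f or t_r if
    [n = 1] and [s] acts on that face as a reflection or a rotation.  The five
    cycle types contribute t_id^4, t_id t_f^2 (6 transpositions), t_id^2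
    (3 double transpositions), t_id t_r (8 three-cycles) and t_id
    (6 four-cycles).

    The numbers t_f and t_r are given for one reflection and one rotation of one
    face.  A reflection of a face is induced by a permutation of order two with
    a fixed point, a rotation by one of order three ([reflection_perm],
    [rotation_perm]); such permutations are conjugate to the standard
    transposition and the standard three-cycle ([conj_transposition],
    [conj_three_cycle]), and conjugation preserves the number of fixed designs
    ([card_fixed_tilesJ]). *)

Set Implicit Arguments.
Unset Strict Implicit.
Unset Printing Implicit Defensive.

Import Order.TTheory GRing.Theory Num.Theory.

(** * Conjugacy classes of the symmetric group on four letters *)

Local Notation "''o_' k" := (@Ordinal 4 k isT)
  (at level 8, k at level 2, format "''o_' k").

Lemma ord4_ind (P : 'I_4 -> Prop) :
  P 'o_0 -> P 'o_1 -> P 'o_2 -> P 'o_3 -> forall i, P i.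
Proof.
move=> P0 P1 P2 P3 [[|[|[|[|[]]]]] //= lti];
  by rewrite (bool_irrelevance lti isT).
Qed.

(** The one-line notation of a permutation of four points.  Unlike a
    permutation, a list of numbers can be computed with, so that finite
    checks over the symmetric group reduce to evaluation. *)
Definition word (s : 'S_4) : seq nat := [seq val (s i) | i <- enum 'I_4].

Lemma nth_word (s : 'S_4) (i : 'I_4) : nth 0 (word s) i = s i.
Proof. by rewrite (nth_map i) ?size_enum_ord // nth_ord_enum. Qed.

Lemma wordE (s : 'S_4) :
  word s = [:: val (s 'o_0); val (s 'o_1); val (s 'o_2); val (s 'o_3)].
Proof.
apply: (@eq_from_nth _ 0); first by rewrite size_map size_enum_ord.
rewrite size_map size_enum_ord => i lti; rewrite (nth_word s (Ordinal lti)).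
by case: i lti => [|[|[|[|[]]]]] //= lti; congr (val (s _)); apply: val_inj.
Qed.

Lemma word_inj : injective word.
Proof.
by move=> s t eq_st; apply/permP=> i; apply: ord_inj; rewrite -!nth_word eq_st.
Qed.

(** The words are distinct rearrangements of 0, 1, 2, 3, and there are as many
    of them as there are rearrangements. *)
Lemma words_S4 :
  perm_eq [seq word s | s <- enum 'S_4] (permutations (iota 0 4)).
Proof.
have sub : {subset [seq word s | s <- enum 'S_4] <= permutations (iota 0 4)}.
  move=> _ /mapP[s _ ->]; rewrite mem_permutations -val_enum_ord.
  rewrite /word map_comp; apply: perm_map; apply: uniq_perm => [||i].
  - by rewrite map_inj_uniq ?enum_uniq //; apply: perm_inj.
  - exact: enum_uniq.
  rewrite mem_enum inE; apply/mapP; exists (s^-1 i)%g;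
    by rewrite ?mem_enum ?permKV.
have uw : uniq [seq word s | s <- enum 'S_4].
  by rewrite map_inj_uniq ?enum_uniq //; apply: word_inj.
apply: uniq_perm; rewrite ?permutations_uniq //.
apply: (uniq_min_size uw sub _).2.
by rewrite size_map -cardE card_Sn size_permutations ?iota_uniq.
Qed.

(** Representatives of the conjugacy classes other than that of the identity.
    Products of permutations are applied from left to right, so the last two
    are 0 -> 1 -> 2 -> 0 and 0 -> 1 -> 2 -> 3 -> 0. *)
Definition transposition : 'S_4 := tperm 'o_0 'o_1.
Definition double_transposition : 'S_4 := (tperm 'o_0 'o_1 * tperm 'o_2 'o_3)%g.
Definition three_cycle : 'S_4 := (tperm 'o_0 'o_1 * tperm 'o_0 'o_2)%g.
Definition four_cycle : 'S_4 :=
  (tperm 'o_0 'o_1 * tperm 'o_0 'o_2 * tperm 'o_0 'o_3)%g.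

Definition S4_rep (k : nat) : 'S_4 :=
  nth 1%g [:: 1%g; transposition; double_transposition; three_cycle;
              four_cycle] k.

Definition rep_word (k : nat) : seq nat :=
  nth [::] [:: [:: 0; 1; 2; 3]; [:: 1; 0; 2; 3]; [:: 1; 0; 3; 2];
               [:: 1; 2; 0; 3]; [:: 1; 2; 3; 0]] k.

Lemma word_rep k : k < 5 -> word (S4_rep k) = rep_word k.
Proof.
case: k => [|[|[|[|[|[]]]]]] //= _; rewrite wordE /S4_rep /= ?perm1 //.
all: rewrite ?/transposition ?/double_transposition ?/three_cycle ?/four_cycle.
all: by rewrite ?permM !permE.
Qed.

(** The number of fixed points determines the cycle type, except that a
    derangement of four points may be an involution or a four-cycle. *)
Definition word_type (w : seq nat) : nat :=
  match count (fun x => nth 0 w x == x) (iota 0 4) with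
  | 4 => 0
  | 2 => 1
  | 1 => 3
  | _ => if all (fun x => nth 0 w (nth 0 w x) == x) (iota 0 4) then 2 else 4
  end.

(** Permutations of the same cycle type are conjugate.  A conjugating
    permutation [p] satisfies [s \o p = p \o S4_rep k], which on words is a
    decidable condition, so it is found by exhaustive search. *)
Lemma conj_rep (s : 'S_4) :
  exists p, word_type (word s) < 5 /\ s = (S4_rep (word_type (word s)) ^ p)%g.
Proof.
have : all (fun c => (word_type c < 5) && has (fun q => all (fun x =>
      nth 0 c (nth 0 q x) == nth 0 q (nth 0 (rep_word (word_type c)) x))
    (iota 0 4)) (permutations (iota 0 4))) (permutations (iota 0 4)).
  by vm_compute.
move/allP=> /(_ (word s)); rewrite -(perm_mem words_S4) map_f ?mem_enum //.
case/(_ isT)/andP=> ltk /hasP[q]; rewrite -(perm_mem words_S4).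
case/mapP=> p _ -> /allP pP; exists p; split=> //.
apply/permP=> i; rewrite -[i](permKV p) permJ; set x := (p^-1 i)%g.
have := pP (val x); rewrite mem_iota /= add0n ltn_ord => /(_ isT).
by rewrite -word_rep // !nth_word => /eqP e; apply: val_inj.
Qed.

(** The class equation of the symmetric group on four letters, with classes of
    sizes 1, 6, 3, 8 and 6. *)
Lemma sum_class_function (F : 'S_4 -> nat) :
    (forall s p, F (s ^ p)%g = F s) ->
  \sum_s F s = F 1%g + F transposition * 6 + F double_transposition * 3
              + F three_cycle * 8 + F four_cycle * 6.
Proof.
move=> FJ; pose G w := F (S4_rep (word_type w)).
have FG s : F s = G (word s).
  by have [p [_ def_s]] := conj_rep s; rewrite {1}def_s FJ.
rewrite (eq_bigr (fun s => G (word s))) // -big_enum /=.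
rewrite -(big_map word xpredT G) (perm_big _ words_S4).
rewrite -(big_map word_type xpredT (fun k => F (S4_rep k))).
have types : perm_eq [seq word_type w | w <- permutations (iota 0 4)]
    (nseq 1 0 ++ nseq 6 1 ++ nseq 3 2 ++ nseq 8 3 ++ nseq 6 4).
  by vm_compute.
rewrite (perm_big _ types) !big_cat !big_nseq !iter_addn_0.
by rewrite /= muln1 !addnA.
Qed.

(** * Tilings acted on by permutations of the faces *)

(** Tilings and tile designs with the geometry forgotten: [I] indexes the faces
    and [b] is the action on pairs of a design and a face. *)
Section Tilings.

Variables (I T : finType) (b : {perm I} -> T * I -> T * I).
Implicit Types (s p : {perm I}) (tau : {ffun I -> T}).

Hypothesis b1 : forall x, b 1%g x = x.
Hypothesis bM : forall s t x, b (s * t)%g x = b t (b s x).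
Hypothesis b_over : forall s x, (b s x).2 = s x.2.

(** The tiling whose graph is the image under [s] of the graph of [tau]. *)
Definition moved_tiling (tau : {ffun I -> T}) (s : {perm I}) : {ffun I -> T} :=
  [ffun j => (b s (tau (s^-1 j)%g, (s^-1 j)%g)).1].

Lemma moved_tilingP tau s i :
  (moved_tiling tau s (s i), s i) = b s (tau i, i).
Proof.
by rewrite ffunE permK [RHS]surjective_pairing b_over.
Qed.

Lemma eq_moved_tiling tau s tau' :
  (forall i, (tau' (s i), s i) = b s (tau i, i)) -> tau' = moved_tiling tau s.
Proof.
move=> eq_b; apply/ffunP=> j; rewrite -(permKV s j).
by have:= eq_b (s^-1 j)%g; rewrite -moved_tilingP => -[].
Qed.

Lemma moved_tiling1 tau : moved_tiling tau 1%g = tau.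
Proof. by apply/esym/eq_moved_tiling=> i; rewrite b1 perm1. Qed.

Lemma moved_tilingM tau s t :
  moved_tiling tau (s * t)%g = moved_tiling (moved_tiling tau s) t.
Proof.
by apply/esym/eq_moved_tiling=> i; rewrite permM bM !moved_tilingP.
Qed.

Canonical tiling_action := TotalAction moved_tiling1 moved_tilingM.
Local Notation to := tiling_action.

Lemma fixed_tilingP (tau : {ffun I -> T}) s :
  reflect (forall i, b s (tau i, i) = (tau (s i), s i)) (tau \in 'Fix_to[s]%g).
Proof.
apply: (iffP afix1P) => [eq_tau i | eq_b].
  by rewrite -moved_tilingP [moved_tiling tau s]eq_tau.
by apply/esym/eq_moved_tiling=> i; rewrite eq_b.
Qed.

Lemma card_fixed_tilingJ s p : #|'Fix_to[s ^ p]%g| = #|'Fix_to[s]%g|.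
Proof.
rewrite -[RHS](card_imset _ (act_inj to p)); apply/eq_card=> tau.
apply/afix1P/imsetP=> [fix_tau | [tau' /afix1P fix_tau' ->]]; last first.
  by rewrite conjgE -actM mulKVg actM fix_tau'.
exists (to tau p^-1%g); last by rewrite actKV.
by apply/afix1P; rewrite -[in RHS]fix_tau conjgE -!actM -!mulgA mulgV mulg1.
Qed.

Definition fixed_tiles s i : {set T} := [set t | b s (t, i) == (t, i)]%SET.

(** The action of [p] carries the designs fixed by [s] on face [i] onto the
    designs fixed by the conjugate of [s] on the face [p i]; this is why the
    numbers of fixed designs do not depend on the face. *)
Lemma card_fixed_tilesJ s p i :
  #|fixed_tiles (s ^ p)%g (p i)| = #|fixed_tiles s i|.
Proof.
have bK x : b p^-1%g (b p x) = x by rewrite -bM mulgV b1.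
have bKV x : b p (b p^-1%g x) = x by rewrite -bM mulVg b1.
have bE t j : b p (t, j) = ((b p (t, j)).1, p j).
  by rewrite [LHS]surjective_pairing b_over.
have injb : injective (fun t => (b p (t, i)).1).
  by move=> t u e; have:= bK (t, i); rewrite bE e -bE bK => -[].
have bJ x : (b (s ^ p)%g (b p x) == b p x) = (b s x == x).
  rewrite -bM conjgE !mulgA mulgV mul1g bM; exact: (inj_eq (can_inj bK)).
rewrite -[RHS](card_imset _ injb); apply/eq_card=> u; rewrite inE.
apply/idP/imsetP=> [fix_u | [t]]; last first.
  by rewrite inE => fix_t ->; rewrite -bE bJ.
have bVE : ((b p^-1%g (u, p i)).1, i) = b p^-1%g (u, p i).
  by rewrite [RHS]surjective_pairing b_over /= permK.
by exists (b p^-1%g (u, p i)).1; rewrite ?inE -?bJ bVE bKV.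
Qed.

(** Burnside's lemma for the action on tilings. *)
Lemma sum_fixed_tilings :
  \sum_s #|'Fix_to[s]%g| =
    #|orbit to [set: {perm I}]%SET @: [set: {ffun I -> T}]%SET| * (#|I|)`!.
Proof.
have GonS : [acts [set: {perm I}]%SET, on [set: {ffun I -> T}]%SET | to].
  by apply/actsP=> s _ tau; rewrite !inE.
transitivity (\sum_(s in [set: {perm I}]%SET)
    #|'Fix_([set: {ffun I -> T}]%SET | to)[s]%g|).
  by apply: eq_big => [s | s _]; rewrite ?finset.setTI ?inE.
rewrite (Frobenius_Cauchy GonS); congr (_ * _).
rewrite -cardsT -card_perm; apply/eq_card=> s.
by rewrite inE; apply/esym/fintype.subsetP=> i _; rewrite inE.
Qed.

End Tilings.

(** * Counting the tilings fixed by each cycle type *)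

Lemma sum_nat_of_uniq (T : finType) (y : T) (P : pred T) :
  (forall x, P x -> x = y) -> \sum_x nat_of_bool (P x) = P y.
Proof.
move=> uniqP; rewrite (big_only1 y) // => x neq_xy _.
by case: (P x) (uniqP x) neq_xy => // ->; rewrite ?eqxx.
Qed.

(** The designs along a cycle of faces are determined by the first of them,
    which must be fixed by going once around the cycle.  In the sums below the
    summand indicates the compatible choices of designs along one cycle. *)
Section SumsOverCycles.

Variables (T : finType).
Implicit Types f g h k : T -> T.

Lemma sum_two_cycle f g :
  \sum_x \sum_y nat_of_bool ((f x == y) && (g y == x)) =
  \sum_x nat_of_bool (g (f x) == x).
Proof.
apply: eq_bigr => x _; rewrite (sum_nat_of_uniq (y := f x)) ?eqxx // => y.
by case/andP=> /eqP.
Qed.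

Lemma sum_three_cycle f g h :
  \sum_x \sum_y \sum_z nat_of_bool [&& f x == y, g y == z & h z == x] =
  \sum_x nat_of_bool (h (g (f x)) == x).
Proof.
rewrite -(sum_two_cycle (g \o f) h); apply: eq_bigr => x _ /=.
rewrite exchange_big; apply: eq_bigr => z _.
rewrite (sum_nat_of_uniq (y := f x)) ?eqxx // => y.
by case/andP=> /eqP.
Qed.

Lemma sum_four_cycle f g h k :
  \sum_x \sum_y \sum_z \sum_t
     nat_of_bool [&& f x == y, g y == z, h z == t & k t == x] =
  \sum_x nat_of_bool (k (h (g (f x))) == x).
Proof.
rewrite -(sum_three_cycle (g \o f) h k); apply: eq_bigr => x _ /=.
rewrite exchange_big; apply: eq_bigr => z _.
rewrite exchange_big; apply: eq_bigr => t _.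
rewrite (sum_nat_of_uniq (y := f x)) ?eqxx // => y.
by case/andP=> /eqP.
Qed.

Lemma sum_split_22 (A B : T -> T -> bool) :
  \sum_x \sum_y \sum_z \sum_t nat_of_bool (A x y && B z t) =
  (\sum_x \sum_y A x y) * (\sum_z \sum_t B z t).
Proof.
rewrite big_distrl; apply: eq_bigr => x _; rewrite big_distrl.
apply: eq_bigr => y _; rewrite big_distrr; apply: eq_bigr => z _.
by rewrite big_distrr; apply: eq_bigr => t _; rewrite /= mulnb.
Qed.

Lemma sum_split_31 (A : T -> T -> T -> bool) (B : T -> bool) :
  \sum_x \sum_y \sum_z \sum_t nat_of_bool (A x y z && B t) =
  (\sum_x \sum_y \sum_z A x y z) * (\sum_t B t).
Proof.
rewrite big_distrl; apply: eq_bigr => x _; rewrite big_distrl.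
apply: eq_bigr => y _; rewrite big_distrl; apply: eq_bigr => z _.
by rewrite big_distrr; apply: eq_bigr => t _; rewrite /= mulnb.
Qed.

End SumsOverCycles.

Definition ffun4 (T : Type) (x y z t : T) : {ffun 'I_4 -> T} :=
  [ffun i : 'I_4 => nth x [:: x; y; z; t] i].

Lemma card_ffun4 (T : finType) (A : {set {ffun 'I_4 -> T}}) :
  #|A| = \sum_x \sum_y \sum_z \sum_t nat_of_bool (ffun4 x y z t \in A).
Proof.
rewrite -sum1_card big_mkcond !pair_bigA /=.
pose tau (p : T * T * T * T) := ffun4 p.1.1.1 p.1.1.2 p.1.2 p.2.
pose pt (f : {ffun 'I_4 -> T}) := (f 'o_0, f 'o_1, f 'o_2, f 'o_3).
rewrite (reindex tau) /=; first by apply: eq_bigr => p _; case: ifP.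
exists pt => [[[[x y] z] t] _ | f _]; first by rewrite /pt !ffunE.
by apply/ffunP; apply: ord4_ind; rewrite ffunE.
Qed.

Lemma transpositionE : [/\ transposition 'o_0 = 'o_1, transposition 'o_1 = 'o_0,
  transposition 'o_2 = 'o_2 & transposition 'o_3 = 'o_3].
Proof. by split; apply: val_inj; rewrite !permE. Qed.

Lemma double_transpositionE :
  [/\ double_transposition 'o_0 = 'o_1, double_transposition 'o_1 = 'o_0,
      double_transposition 'o_2 = 'o_3 & double_transposition 'o_3 = 'o_2].
Proof. by split; apply: val_inj; rewrite !permM !permE. Qed.

Lemma three_cycleE : [/\ three_cycle 'o_0 = 'o_1, three_cycle 'o_1 = 'o_2,
  three_cycle 'o_2 = 'o_0 & three_cycle 'o_3 = 'o_3].
Proof. by split; apply: val_inj; rewrite !permM !permE. Qed.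

Lemma four_cycleE : [/\ four_cycle 'o_0 = 'o_1, four_cycle 'o_1 = 'o_2,
  four_cycle 'o_2 = 'o_3 & four_cycle 'o_3 = 'o_0].
Proof. by split; apply: val_inj; rewrite !permM !permE. Qed.

Section TetrahedralTilings.

Variables (T : finType) (b : 'S_4 -> T * 'I_4 -> T * 'I_4).
Implicit Types s t : 'S_4.

Hypothesis b1 : forall x, b 1%g x = x.
Hypothesis bM : forall s t x, b (s * t)%g x = b t (b s x).
Hypothesis b_over : forall s x, (b s x).2 = s x.2.

Local Notation to := (tiling_action b1 bM b_over).
Local Notation col s i x := (b s (x, i)).1.

Let colM s t i x : col (s * t)%g i x = col t (s i) (col s i x).
Proof. by rewrite bM [b s _]surjective_pairing b_over. Qed.

Let card_col s i : s i = i ->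
  \sum_x nat_of_bool (col s i x == x) = #|fixed_tiles b s i|.
Proof.
move=> si; rewrite -sum1_card [RHS]big_mkcond; apply: eq_bigr => x _.
rewrite inE [b s _]surjective_pairing b_over /= si xpair_eqE eqxx andbT.
by case: eqP.
Qed.

Let mem_fixed s (f : {ffun 'I_4 -> T}) : (f \in 'Fix_to[s]%g) =
  [&& col s 'o_0 (f 'o_0) == f (s 'o_0), col s 'o_1 (f 'o_1) == f (s 'o_1),
      col s 'o_2 (f 'o_2) == f (s 'o_2) & col s 'o_3 (f 'o_3) == f (s 'o_3)].
Proof.
apply/fixed_tilingP/and4P=> [fix_f | [/eqP f0 /eqP f1 /eqP f2 /eqP f3] i].
  by rewrite !fix_f.
rewrite [LHS]surjective_pairing b_over /=; congr (_, _).
by move: i; apply: ord4_ind.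
Qed.

Let card_fixed s : #|'Fix_to[s]%g| =
  \sum_x0 \sum_x1 \sum_x2 \sum_x3
   let f (i : 'I_4) := nth x0 [:: x0; x1; x2; x3] i in
   nat_of_bool [&& col s 'o_0 x0 == f (s 'o_0), col s 'o_1 x1 == f (s 'o_1),
      col s 'o_2 x2 == f (s 'o_2) & col s 'o_3 x3 == f (s 'o_3)].
Proof.
rewrite card_ffun4; do 4!apply: eq_bigr => ? _.
by apply: (congr1 nat_of_bool); rewrite mem_fixed !ffunE.
Qed.

Lemma card_fixed_id : #|'Fix_to[1]%g| = #|T| ^ 4.
Proof.
have -> : 'Fix_to[1]%g = [set: {ffun 'I_4 -> T}]%SET.
  by apply/setP=> f; rewrite [RHS]inE mem_fixed !perm1 !b1 !eqxx.
by rewrite cardsT card_ffun card_ord.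
Qed.

Let sum_eqT f :
  (forall x, f x = x) -> \sum_x nat_of_bool (f x == x :> T) = #|T|.
Proof.
by move=> fE; rewrite -sum1_card; apply: eq_bigr => x _; rewrite fE eqxx.
Qed.

Lemma card_fixed_transposition :
  #|'Fix_to[transposition]%g| = #|T| * #|fixed_tiles b transposition 'o_2| ^ 2.
Proof.
have [e0 e1 e2 e3] := transpositionE; set s := transposition in e0 e1 e2 e3 *.
have ss : (s * s = 1)%g by apply: tperm2.
(* A permutation commuting with s exchanges its two fixed faces. *)
have eq_w : #|fixed_tiles b s 'o_3| = #|fixed_tiles b s 'o_2|.
  have sJ : (s ^ tperm 'o_2 'o_3)%g = s by rewrite tpermJ !tpermD.
  rewrite -[RHS](card_fixed_tilesJ b1 bM b_over s (tperm 'o_2 'o_3)).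
  by rewrite tpermL sJ.
transitivity (\sum_x \sum_y \sum_z \sum_t
    nat_of_bool (((col s 'o_0 x == y) && (col s 'o_1 y == x)) &&
                 ((col s 'o_2 z == z) && (col s 'o_3 t == t)))).
  rewrite card_fixed e0 e1 e2 e3 /=; do 4!apply: eq_bigr => ? _.
  by rewrite andbA.
rewrite sum_split_22 sum_two_cycle sum_eqT => [|x].
  congr (_ * _); rewrite expnS expn1 -{2}eq_w -!card_col // big_distrlr.
  by do 2!apply: eq_bigr => ? _; rewrite /= mulnb.
by rewrite -e0 -colM ss b1.
Qed.

Lemma card_fixed_double_transposition :
  #|'Fix_to[double_transposition]%g| = #|T| ^ 2.
Proof.
have [e0 e1 e2 e3] := double_transpositionE.
move: double_transposition e0 e1 e2 e3 => s e0 e1 e2 e3.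
have ss : (s * s = 1)%g.
  apply/permP; apply: ord4_ind; rewrite !permM perm1;
    by rewrite ?(e0, e1, e2, e3).
transitivity (\sum_x \sum_y \sum_z \sum_t
    nat_of_bool (((col s 'o_0 x == y) && (col s 'o_1 y == x)) &&
                 ((col s 'o_2 z == t) && (col s 'o_3 t == z)))).
  rewrite card_fixed e0 e1 e2 e3 /=; do 4!apply: eq_bigr => ? _.
  by rewrite andbA.
rewrite sum_split_22 !sum_two_cycle !sum_eqT // => x.
  by rewrite -e2 -colM ss b1.
by rewrite -e0 -colM ss b1.
Qed.

Lemma card_fixed_three_cycle :
  #|'Fix_to[three_cycle]%g| = #|T| * #|fixed_tiles b three_cycle 'o_3|.
Proof.
have [e0 e1 e2 e3] := three_cycleE.
move: three_cycle e0 e1 e2 e3 => s e0 e1 e2 e3.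
have sss : (s * s * s = 1)%g.
  apply/permP; apply: ord4_ind; rewrite !permM perm1;
    by rewrite ?(e0, e1, e2, e3).
transitivity (\sum_x \sum_y \sum_z \sum_t
    nat_of_bool ([&& col s 'o_0 x == y, col s 'o_1 y == z & col s 'o_2 z == x]
                 && (col s 'o_3 t == t))).
  rewrite card_fixed e0 e1 e2 e3 /=; do 4!apply: eq_bigr => ? _.
  by rewrite !andbA.
rewrite sum_split_31 sum_three_cycle sum_eqT => [|x]; first by rewrite card_col.
by rewrite -e1 -e0 -!colM mulgA sss b1.
Qed.

Lemma card_fixed_four_cycle : #|'Fix_to[four_cycle]%g| = #|T|.
Proof.
have [e0 e1 e2 e3] := four_cycleE.
move: four_cycle e0 e1 e2 e3 => s e0 e1 e2 e3.
have ssss : (s * s * s * s = 1)%g.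
  apply/permP; apply: ord4_ind; rewrite !permM perm1;
    by rewrite ?(e0, e1, e2, e3).
rewrite card_fixed e0 e1 e2 e3 /= sum_four_cycle sum_eqT // => x.
by rewrite -e2 -e1 -e0 -!colM !mulgA ssss b1.
Qed.

Lemma count_tilings :
  #|orbit to [set: 'S_4]%SET @: [set: {ffun 'I_4 -> T}]%SET| * 24 =
  #|T| ^ 4 + #|T| * #|fixed_tiles b transposition 'o_2| ^ 2 * 6 + #|T| ^ 2 * 3
  + #|T| * #|fixed_tiles b three_cycle 'o_3| * 8 + #|T| * 6.
Proof.
have := sum_fixed_tilings b1 bM b_over; rewrite card_ord => <-.
rewrite sum_class_function => [|s p]; last exact: card_fixed_tilingJ.
rewrite card_fixed_id card_fixed_transposition card_fixed_double_transposition.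
by rewrite card_fixed_three_cycle card_fixed_four_cycle.
Qed.

End TetrahedralTilings.

(** Among the elements of order two of the symmetric group on four letters, the
    transpositions are those with a fixed point.  The conjugating permutation
    can be chosen to carry a given fixed point of the standard transposition to
    a given fixed point of [s]. *)
Lemma conj_transposition (s : 'S_4) (i : 'I_4) :
    s != 1%g -> (s * s = 1)%g -> s i = i ->
  exists2 p, s = (transposition ^ p)%g & i = p 'o_2.
Proof.
have [p [lt5 def_s]] := conj_rep s.
move: (word_type _) lt5 def_s => k lt5 def_s.
have [j def_i] : exists j, i = p j by exists (p^-1 i)%g; rewrite permKV.
rewrite def_s def_i permJ => neq1 sq1 /perm_inj fix_j.
have neq1k : S4_rep k != 1%g.
  by apply: contraNneq neq1 => ->; rewrite conj1g.
have sq1k : (S4_rep k * S4_rep k = 1)%g.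
  by apply: (conjg_inj p); rewrite conjMg sq1 conj1g.
have {}sq1k x : S4_rep k (S4_rep k x) = x by rewrite -permM sq1k perm1.
case: k lt5 neq1k sq1k fix_j {def_s neq1 sq1} => [|[|[|[|[|[]]]]]] // _;
  rewrite /S4_rep /= ?eqxx // => _ sq1 fix_j.
- have [e0 e1 e2 e3] := transpositionE.
  have : (j == 'o_2) || (j == 'o_3).
    by move: j fix_j {def_i}; apply: ord4_ind; rewrite ?(e0, e1).
  case/orP=> /eqP->; first by exists p.
  exists (tperm 'o_2 'o_3 * p)%g; last by rewrite permM tpermL.
  by rewrite conjgM; congr (_ ^ p)%g; rewrite tpermJ !tpermD.
- have [e0 e1 e2 e3] := double_transpositionE.
  by move: j fix_j {def_i}; apply: ord4_ind; rewrite ?(e0, e1, e2, e3).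
- have [e0 e1 e2 e3] := three_cycleE.
  by have := sq1 'o_0; rewrite e0 e1.
- have [e0 e1 e2 e3] := four_cycleE.
  by have := sq1 'o_0; rewrite e0 e1.
Qed.

Lemma conj_three_cycle (s : 'S_4) (i : 'I_4) :
    s != 1%g -> (s * s * s = 1)%g -> s i = i ->
  exists2 p, s = (three_cycle ^ p)%g & i = p 'o_3.
Proof.
have [p [lt5 def_s]] := conj_rep s.
move: (word_type _) lt5 def_s => k lt5 def_s.
have [j def_i] : exists j, i = p j by exists (p^-1 i)%g; rewrite permKV.
rewrite def_s def_i permJ => neq1 sq1 /perm_inj fix_j.
have neq1k : S4_rep k != 1%g.
  by apply: contraNneq neq1 => ->; rewrite conj1g.
have sq1k : (S4_rep k * S4_rep k * S4_rep k = 1)%g.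
  by apply: (conjg_inj p); rewrite !conjMg sq1 conj1g.
have {}sq1k x : S4_rep k (S4_rep k (S4_rep k x)) = x.
  by rewrite -!permM mulgA sq1k perm1.
case: k lt5 neq1k sq1k fix_j {def_s neq1 sq1} => [|[|[|[|[|[]]]]]] // _;
  rewrite /S4_rep /= ?eqxx // => _ sq1 fix_j.
- have [e0 e1 e2 e3] := transpositionE.
  by have := sq1 'o_0; rewrite e0 e1 e0.
- have [e0 e1 e2 e3] := double_transpositionE.
  by have := sq1 'o_0; rewrite e0 e1 e0.
- exists p => //; congr (p _); have [e0 e1 e2 e3] := three_cycleE.
  by move: j fix_j {def_i}; apply: ord4_ind; rewrite ?(e0, e1, e2).
- have [e0 e1 e2 e3] := four_cycleE.
  by have := sq1 'o_0; rewrite e0 e1 e2.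
Qed.

Local Open Scope classical_set_scope.
Local Open Scope ring_scope.

(** * The symmetry group of the tetrahedron *)

Section Geometry.

Variable R : realType.
Implicit Types s t : 'S_4.

Lemma dotE (x y : 'cV[R]_3) : dot x y = \sum_k x k 0 * y k 0.
Proof. by rewrite /dot mxE; apply: eq_bigr => k _; rewrite mxE. Qed.

Lemma dotC (x y : 'cV[R]_3) : dot x y = dot y x.
Proof. by rewrite !dotE; apply: eq_bigr => k _; rewrite mulrC. Qed.

Lemma dotDr (x y z : 'cV[R]_3) : dot x (y + z) = dot x y + dot x z.
Proof. by rewrite /dot mulmxDr mxE. Qed.

Lemma dotZr a (x y : 'cV[R]_3) : dot x (a *: y) = a * dot x y.
Proof. by rewrite /dot -scalemxAr mxE. Qed.

Lemma dotBr (x y z : 'cV[R]_3) : dot x (y - z) = dot x y - dot x z.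
Proof. by rewrite dotDr -scaleN1r dotZr mulN1r. Qed.

Lemma dotBl (x y z : 'cV[R]_3) : dot (x - y) z = dot x z - dot y z.
Proof. by rewrite dotC dotBr !(dotC z). Qed.

Lemma dotZl a (x y : 'cV[R]_3) : dot (a *: x) y = a * dot x y.
Proof. by rewrite dotC dotZr dotC. Qed.

Lemma dot_sumr (I : finType) (x : 'cV[R]_3) (F : I -> 'cV[R]_3) :
  dot x (\sum_i F i) = \sum_i dot x (F i).
Proof.
by rewrite /dot mulmx_sumr summxE.
Qed.

(** The four vertices (1,1,1), (1,-1,-1), (-1,1,-1), (-1,-1,1). *)
Definition vertex (i : 'I_4) : 'cV[R]_3 :=
  \col_(k < 3) (if (i == 0 :> nat) || (i == k.+1 :> nat) then 1 else -1).

Lemma dot_vertex i j : dot (vertex i) (vertex j) = if i == j then 3 else -1.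
Proof.
rewrite dotE !big_ord_recl big_ord0 !mxE.
by case: i => [[|[|[|[|[]]]]] //= ?]; case: j => [[|[|[|[|[]]]]] //= ?]; ring.
Qed.

(** The vertices form a tight frame: although they are linearly dependent,
    vectors are reconstructed from their scalar products with them. *)
Lemma vertex_frame : 4^-1 *: \sum_i vertex i *m (vertex i)^T = 1%:M :> 'M[R]_3.
Proof.
apply/matrixP=> k l; rewrite mxE summxE !big_ord_recl big_ord0 !mxE.
rewrite !big_ord_recl !big_ord0 !mxE.
by case: k => [[|[|[|[]]]] //= ?]; case: l => [[|[|[|[]]]] //= ?]; field.
Qed.

Lemma sum_vertex : \sum_i vertex i = 0.
Proof.
apply/colP=> k; rewrite summxE !big_ord_recl big_ord0 !mxE.
by case: k => [[|[|[|[]]]] //= ?]; ring.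
Qed.

Lemma sum_dot_vertex (x : 'cV[R]_3) : \sum_i dot (vertex i) x = 0.
Proof.
under eq_bigr do rewrite dotC.
by rewrite -dot_sumr sum_vertex /dot mulmx0 mxE.
Qed.

Lemma outer_mulmx (x y z : 'cV[R]_3) : x *m y^T *m z = dot y z *: x.
Proof. by rewrite -mulmxA [y^T *m z]mx11_scalar mul_mx_scalar. Qed.

Lemma dot_vertexK (x : 'cV[R]_3) :
  4^-1 *: \sum_i dot (vertex i) x *: vertex i = x.
Proof.
rewrite -[RHS]mul1mx -vertex_frame -scalemxAl mulmx_suml; congr (_ *: _).
by apply: eq_bigr => i _; rewrite outer_mulmx.
Qed.

Lemma eq_on_vertices (A B : 'M[R]_3) :
  (forall i, A *m vertex i = B *m vertex i) -> A = B.
Proof.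
move=> eqAB; rewrite -[A]mulmx1 -[B]mulmx1 -vertex_frame.
rewrite -!scalemxAr !mulmx_sumr.
by congr (_ *: _); apply: eq_bigr => i _; rewrite !mulmxA eqAB.
Qed.

(** The linear isometry permuting the vertices as [s] does: the frame identity
    with its left factors permuted. *)
Definition perm_matrix s : 'M[R]_3 :=
  4^-1 *: \sum_i vertex (s i) *m (vertex i)^T.

Lemma perm_matrix_vertex s i : perm_matrix s *m vertex i = vertex (s i).
Proof.
rewrite -[RHS]dot_vertexK -scalemxAl mulmx_suml; congr (_ *: _).
rewrite [RHS](reindex_inj (@perm_inj _ s)); apply: eq_bigr => j _.
by rewrite outer_mulmx !dot_vertex (inj_eq perm_inj).
Qed.

Lemma perm_matrix1 : perm_matrix 1 = 1%:M.
Proof.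
by apply: eq_on_vertices => i; rewrite perm_matrix_vertex perm1 mul1mx.
Qed.

Lemma perm_matrixM s t : perm_matrix (s * t) = perm_matrix t *m perm_matrix s.
Proof.
by apply: eq_on_vertices => i; rewrite -mulmxA !perm_matrix_vertex permM.
Qed.

Lemma tr_perm_matrix s : (perm_matrix s)^T = perm_matrix s^-1.
Proof.
rewrite /perm_matrix linearZ linear_sum /=; congr (_ *: _).
rewrite (reindex_inj (@perm_inj _ s^-1%g)); apply: eq_bigr => i _.
by rewrite trmx_mul trmxK permKV.
Qed.

Lemma dot_perm_matrix s (x : 'cV[R]_3) i :
  dot (vertex (s i)) (perm_matrix s *m x) = dot (vertex i) x.
Proof.
by rewrite -perm_matrix_vertex /dot trmx_mul tr_perm_matrix -mulmxA
   [_ *m (_ *m x)]mulmxA -perm_matrixM mulgV perm_matrix1 mul1mx.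
Qed.

Lemma vertex_dot_inj (x y : 'cV[R]_3) :
  (forall i, dot (vertex i) x = dot (vertex i) y) -> x = y.
Proof.
move=> eq_xy; rewrite -(dot_vertexK x) -(dot_vertexK y).
by congr (_ *: _); apply: eq_bigr => i _; rewrite eq_xy.
Qed.

Lemma vertex_inj : injective vertex.
Proof.
move=> i j eq_ij; apply/eqP.
have := dot_vertex i j; rewrite eq_ij dot_vertex eqxx.
case: eqP => // _; lra.
Qed.

Lemma perm_matrix_unit s : perm_matrix s \in unitmx.
Proof.
have /mulmx1_unit[] // : perm_matrix s *m perm_matrix s^-1 = 1%:M.
by rewrite -perm_matrixM mulVg perm_matrix1.
Qed.

Lemma perm_matrixV s : invmx (perm_matrix s) = perm_matrix s^-1.
Proof.
rewrite -[LHS]mulmx1 -perm_matrix1 -(mulVg s) perm_matrixM mulKmx //.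
exact: perm_matrix_unit.
Qed.

Lemma group_perm_matrix : matrix_group (range perm_matrix).
Proof.
split=> [_ [s _ <-]||_ _ [s _ <-] [t _ <-]|_ [s _ <-]].
- exact: perm_matrix_unit.
- by exists 1%g; rewrite ?perm_matrix1.
- by exists (t * s)%g; rewrite ?perm_matrixM.
- by exists s^-1%g; rewrite ?perm_matrixV.
Qed.

Lemma R0E : R0 R = perm_matrix (tperm 'o_1 'o_2).
Proof.
apply: eq_on_vertices => i; rewrite perm_matrix_vertex permE /=.
apply/colP=> k; rewrite !mxE !big_ord_recl big_ord0 !mxE.
by case: i => [[|[|[|[|[]]]]] //= ?]; case: k => [[|[|[|[]]]] //= ?]; ring.
Qed.

Lemma R1E : R1 R = perm_matrix (tperm 'o_2 'o_3).
Proof.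
apply: eq_on_vertices => i; rewrite perm_matrix_vertex permE /=.
apply/colP=> k; rewrite !mxE !big_ord_recl big_ord0 !mxE.
by case: i => [[|[|[|[|[]]]]] //= ?]; case: k => [[|[|[|[]]]] //= ?]; ring.
Qed.

Lemma R2E : R2 R = perm_matrix (tperm 'o_0 'o_3).
Proof.
apply: eq_on_vertices => i; rewrite perm_matrix_vertex permE /=.
apply/colP=> k; rewrite !mxE !big_ord_recl big_ord0 !mxE.
by case: i => [[|[|[|[|[]]]]] //= ?]; case: k => [[|[|[|[]]]] //= ?]; ring.
Qed.

(** The three transpositions form a connected graph on the four points, so
    their conjugates are all transpositions, which generate. *)
Lemma S4_generated (G : set 'S_4) :
    (forall s t, G s -> G t -> G (s * t)%g) ->
    G (tperm 'o_1 'o_2) -> G (tperm 'o_2 'o_3) -> G (tperm 'o_0 'o_3) ->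
  forall s, G s.
Proof.
move=> GM G12 G23 G03.
have GJ i j k l : G (tperm i j) -> G (tperm k l) ->
    G (tperm (tperm k l i) (tperm k l j)).
  move=> Gij Gkl; rewrite -tpermJ conjgE tpermV; apply: (GM) => //.
  exact: GM.
have G13 : G (tperm 'o_1 'o_3).
  by have := GJ _ _ _ _ G12 G23; rewrite tpermL tpermD.
have G02 : G (tperm 'o_0 'o_2).
  by have := GJ _ _ _ _ G03 G23; rewrite tpermR tpermD.
have G01 : G (tperm 'o_0 'o_1).
  by have := GJ _ _ _ _ G02 G12; rewrite tpermR tpermD.
have G1 : G 1%g by rewrite -(tperm2 'o_0 'o_1); apply: GM.
have Gt : forall i j, G (tperm i j).
  by apply: ord4_ind; apply: ord4_ind; rewrite ?tperm1 // tpermC.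
move=> s; have [ts -> _] := prod_tpermP s.
by apply: big_ind => // t _; apply: Gt.
Qed.

(** Full tetrahedral symmetry is the symmetric group on the vertices: the
    generators act on the vertices as transpositions, and these generate. *)
Lemma TdE : Td R = range perm_matrix.
Proof.
apply/seteqP; split.
  apply: smallest_sub; first exact: group_perm_matrix.
  by move=> A [[->|->]|->]; rewrite ?R0E ?R1E ?R2E; eexists.
move=> _ [s _ <-] G [[_ _ GM _] sG].
apply: (@S4_generated (G \o perm_matrix)) => [t u Gt Gu /=|||].
- by rewrite perm_matrixM; apply: GM.
- by rewrite /= -R0E; apply: sG; left; left.
- by rewrite /= -R1E; apply: sG; left; right.
- by rewrite /= -R2E; apply: sG; right.
Qed.

(** * The faces of the tetrahedron *)

Lemma conv_lmodE (p : {i01 R}) (x y : 'cV[R]_3) :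
  conv p (x : convex_lmodType _) y = p%:num *: x + (1 - p%:num) *: y.
Proof. by []. Qed.

Lemma convex_combination (C : set 'cV[R]_3) n (w : 'I_n -> R)
    (p : 'I_n -> 'cV[R]_3) :
    convex_set C -> (forall i, C (p i)) -> (forall i, 0 <= w i) ->
    \sum_i w i = 1 ->
  C (\sum_i w i *: p i).
Proof.
move=> cvxC; elim: n w p => [|n IHn] w p Cp w_ge0.
  by rewrite big_ord0 => /esym/eqP; rewrite oner_eq0.
rewrite !big_ord_recl => sum_w.
have sum_w' : \sum_(i < n) w (lift ord0 i) = 1 - w ord0.
  by rewrite -sum_w addrC addKr.
have w0_le1 : w ord0 <= 1.
  by rewrite -subr_ge0 -sum_w' sumr_ge0.
have [w0_1 | w0_neq1] := eqVneq (w ord0) 1.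
  rewrite w0_1 scale1r big1 ?addr0 // => i _.
  by move: sum_w'; rewrite w0_1 subrr => /psumr_eq0P -> //; rewrite scale0r.
have w1_neq0 : 1 - w ord0 != 0 by rewrite subr_eq0 eq_sym.
pose q := \sum_(i < n) (w (lift ord0 i) / (1 - w ord0)) *: p (lift ord0 i).
have Cq : C q.
  apply: IHn => // [i|]; first by rewrite divr_ge0 ?subr_ge0.
  by rewrite -mulr_suml sum_w' divff.
have := cvxC (p ord0) q (Itv01 (w_ge0 ord0) w0_le1) (mem_set (Cp ord0))
  (mem_set Cq).
rewrite inE conv_lmodE /=; congr C; rewrite /q scaler_sumr; congr (_ + _).
by apply: eq_bigr => i _; rewrite scalerA mulrC divfK.
Qed.

Lemma orbit_vertex :
  [set A *m (const_mx 1 : 'cV[R]_3) | A in Td R] = range vertex.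
Proof.
have v0 : const_mx 1 = vertex 'o_0 by apply/colP=> k; rewrite !mxE.
rewrite TdE v0; apply/seteqP; split=> [_ [_ [s _ <-] <-] | _ [i _ <-]].
  by rewrite perm_matrix_vertex; exists (s 'o_0).
exists (perm_matrix (tperm 'o_0 i)); first by exists (tperm 'o_0 i).
by rewrite perm_matrix_vertex tpermL.
Qed.

(** A point of the tetrahedron has the barycentric coordinates
    [(1 + dot (vertex i) x) / 4]: they sum to 1 and reconstruct [x] because the
    vertices sum to 0 and form a tight frame. *)
Lemma tetrahedronE :
  tetrahedron R = [set x | forall i, -1 <= dot (vertex i) x].
Proof.
rewrite /tetrahedron orbit_vertex; apply/seteqP; split.
  apply: smallest_sub => [x y l /set_mem Px /set_mem Py | _ [j _ <-] i].
    apply/mem_set => i; rewrite conv_lmodE dotDr !dotZr.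
    have := Px i; have := Py i.
    have : 0 <= l%:num by [].
    have : l%:num <= 1 by [].
    nra.
  by rewrite dot_vertex; case: ifP => // _; lra.
move=> x Px C [cvxC vC]; rewrite -(dot_vertexK x).
have -> : 4^-1 *: \sum_i dot (vertex i) x *: vertex i =
          \sum_i ((1 + dot (vertex i) x) / 4) *: vertex i.
  rewrite scaler_sumr; under [RHS]eq_bigr do rewrite mulrDl scalerDl.
  rewrite big_split /= -[X in _ = X + _]scaler_sumr sum_vertex scaler0 add0r.
  by apply: eq_bigr => i _; rewrite scalerA mulrC.
apply: convex_combination => // [i | i |].
- by apply: vC; exists i.
- by have := Px i; lra.
rewrite -mulr_suml big_split /= sum_dot_vertex addr0 sumr_const card_ord.
by field.
Qed.

(** The face opposite to [vertex i]. *)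
Definition face (i : 'I_4) : set 'cV[R]_3 :=
  tetrahedron R `&` [set x | dot (vertex i) x = -1].

Lemma tetrahedron_vertex i : tetrahedron R (vertex i).
Proof.
by rewrite tetrahedronE => j; rewrite dot_vertex; case: ifP => // _; lra.
Qed.

Lemma face_vertex i j : face i (vertex j) <-> i != j.
Proof.
split=> [[_ /=] | neq_ij]; first by rewrite dot_vertex; case: eqP => // _; lra.
by split; [apply: tetrahedron_vertex | rewrite /= dot_vertex (negPf neq_ij)].
Qed.

Lemma face_inj : injective face.
Proof.
move=> i j eq_F; apply: contrapT => /eqP neq_ij.
by have /face_vertex := neq_ij; rewrite eq_F => /face_vertex; rewrite eqxx.
Qed.

Lemma move_face s i : move (perm_matrix s) (face i) = face (s i).
Proof.
have sub t j x : face j x -> face (t j) (perm_matrix t *m x).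
  rewrite /face !tetrahedronE => -[Px Fx].
  split; last by rewrite /= dot_perm_matrix.
  by move=> k; rewrite -(permKV t k) dot_perm_matrix.
apply/seteqP; split=> [_ [x Fx <-] | x Fx]; first exact: sub.
exists (perm_matrix s^-1 *m x); last first.
  by rewrite mulmxA -perm_matrixM mulVg perm_matrix1 mul1mx.
by rewrite -{1}(permK s i); apply: sub.
Qed.

(** Two vertices and the differences from a third one are, up to the factor 4,
    dual to each other; both pairs are therefore linearly independent. *)
Lemma vertices_dual_basis i j k : i != j -> i != k -> j != k ->
  col_mx (vertex i)^T (vertex j)^T *m
    row_mx (vertex i - vertex k) (vertex j - vertex k) = 4%:M.
Proof.
move=> ij ik jk; rewrite mul_col_row scalar_mx_block.
have E (x y : 'cV[R]_3) : x^T *m y = (dot x y)%:M by exact: mx11_scalar.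
rewrite !E !dotBr !dot_vertex !eqxx (eq_sym j i).
rewrite !(negPf ij) (negPf ik) (negPf jk).
have -> : 3 - -1 = 4 :> R by ring.
rewrite subrr; congr block_mx;
  by apply/matrixP=> k' l; rewrite !mxE mul0rn.
Qed.

Lemma vertices_free i j k : i != j -> i != k -> j != k ->
  \rank (col_mx (vertex i)^T (vertex j)^T) = 2%N /\
  \rank (row_mx (vertex i - vertex k) (vertex j - vertex k)) = 2%N.
Proof.
move=> ij ik jk; have dual := vertices_dual_basis ij ik jk.
have rank4 : \rank (4%:M : 'M[R]_(1 + 1)) = 2%N.
  by rewrite -scalemx1 mxrank_scale_nz ?mxrank1 // pnatr_eq0.
split; apply/eqP; rewrite eqn_leq.
  by rewrite rank_leq_row -{1}rank4 -dual mxrankM_maxl.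
by rewrite rank_leq_col -{1}rank4 -dual mxrankM_maxr.
Qed.

Lemma exists_other (A : {set 'I_4}) : (#|A| < 4)%N -> exists k, k \notin A.
Proof.
move=> ltA; have /subsetPn[k _ kA] : ~~ ([set: 'I_4]%SET \subset A);
  last by exists k.
by apply: contraL ltA => /subset_leq_card; rewrite cardsT card_ord -leqNgt.
Qed.

(** A set lying in two face planes lies on a line, since the normals of these
    planes are independent. *)
Lemma two_tight_vertices_rank i j (a b c : 'cV[R]_3) :
    i != j ->
    (forall x, x \in [:: a; b; c] ->
       dot (vertex i) x = -1 /\ dot (vertex j) x = -1) ->
  \rank (row_mx (b - a) (c - a)) != 2%N.
Proof.
move=> ij tight; have [k] : exists k, k \notin [set i; j]%SET.
  by apply: exists_other; rewrite cards2; case: (_ != _).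
rewrite !inE negb_or => /andP[ki kj].
have [ik jk] : i != k /\ j != k by rewrite !(eq_sym _ k).
have [rank_ij _] := vertices_free ij ik jk.
have := mulmx0_rank_max (A := col_mx (vertex i)^T (vertex j)^T)
  (B := row_mx (b - a) (c - a)).
rewrite rank_ij mul_col_row.
have E (x y : 'cV[R]_3) : x^T *m y = (dot x y)%:M by exact: mx11_scalar.
rewrite !E !dotBr.
have /tight[-> ->] : a \in [:: a; b; c] by rewrite !inE eqxx.
have /tight[-> ->] : b \in [:: a; b; c] by rewrite !inE eqxx orbT.
have /tight[-> ->] : c \in [:: a; b; c] by rewrite !inE eqxx !orbT.
rewrite !subrr !(raddf0 (@scalar_mx R 1)) block_mx0 => /(_ erefl).
by case: (\rank _) => [|[|[|]]].
Qed.

(** Let [dot u x <= h] be a supporting half-space.  Writing a point of the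
    supporting plane by its barycentric coordinates makes [h - dot u x = 0] a
    sum of nonnegative products of a coordinate and a slack
    [h - dot u (vertex i)], so the coordinate of each vertex with nonzero slack
    vanishes.  Some slack is nonzero as [u != 0]; two nonzero slacks would
    confine the intersection to a line.  So exactly one vertex is off the plane,
    and the intersection is the opposite face. *)
Lemma facesE : faces (tetrahedron R) = range face.
Proof.
apply/seteqP; split; last first.
  move=> _ [l _ <-]; split.
    exists (- vertex l), 1.
    have dotN x : dot (- vertex l) x = - dot (vertex l) x.
      by rewrite -scaleN1r dotZl mulN1r.
    split.
    - rewrite oppr_eq0; apply: contra_eqN (dot_vertex l l) => /eqP->.
      by rewrite eqxx /dot mulmx0 mxE eq_sym pnatr_eq0.
    - by move=> x; rewrite tetrahedronE dotN => /(_ l); lra.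
    apply/seteqP; split=> x [Px /= Fx]; split=> //=.
      by rewrite dotN Fx opprK.
    by move: Fx; rewrite dotN; lra.
  have [k] : exists k, k \notin [set l]%SET.
    by apply: exists_other; rewrite cards1.
  have [j] : exists j, j \notin [set l; k]%SET.
    by apply: exists_other; rewrite cards2; case: (_ != _).
  have [i] : exists i, i \notin [set l; k; j]%SET.
    apply: exists_other; rewrite finset.setUC cardsU1 cards2.
    by case: (_ != _); case: (_ \in _).
  rewrite !inE !negb_or -!andbA => /and3P[il ik ij] /andP[jl jk] kl.
  exists (vertex k), (vertex i), (vertex j).
  split; [apply/face_vertex; rewrite eq_sym // .. |].
  by apply: (vertices_free ij ik jk).2.
move=> F [[u [h [u_neq0 le_h ->]]] [a [b [c [Fa Fb Fc rank2]]]]].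
pose d i := h - dot u (vertex i).
have d_ge0 i : 0 <= d i.
  by rewrite /d subr_ge0; apply: le_h; apply: tetrahedron_vertex.
have sum_d x : \sum_i (1 + dot (vertex i) x) * d i = 4 * (h - dot u x).
  have sum_q : \sum_i dot u (vertex i) = 0.
    by rewrite -[RHS](sum_dot_vertex u); apply: eq_bigr => i _; rewrite dotC.
  have sum_pq : \sum_i dot (vertex i) x * dot u (vertex i) = 4 * dot u x.
    rewrite -[in RHS](dot_vertexK x) dotZr mulrA divff ?pnatr_eq0 // mul1r.
    by rewrite dot_sumr; apply: eq_bigr => i _; rewrite dotZr.
  transitivity (\sum_i (h - dot u (vertex i) + dot (vertex i) x * h
                        - dot (vertex i) x * dot u (vertex i))).
    by apply: eq_bigr => i _; rewrite /d; ring.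
  rewrite sumrB big_split /= sumrB -mulr_suml sum_q sum_dot_vertex sum_pq.
  by rewrite sumr_const card_ord -mulr_natl; ring.
have tight x i : tetrahedron R x -> dot u x = h -> d i != 0 ->
    dot (vertex i) x = -1.
  rewrite tetrahedronE => Px ux di; have := sum_d x; rewrite ux subrr mulr0.
  move/psumr_eq0P=> terms0; apply/eqP; rewrite -addr_eq0 addrC.
  have /eqP : (1 + dot (vertex i) x) * d i = 0.
    by apply: terms0 => // k _; rewrite mulr_ge0 //; have := Px k; lra.
  by rewrite mulf_eq0 (negPf di) orbF.
have [i di] : exists i, d i != 0.
  apply: contrapT => /forallNP all0.
  case/eqP: u_neq0; apply: vertex_dot_inj => i.
  have uh j : dot u (vertex j) = h.
    by have /negP := all0 j; rewrite negbK subr_eq0 => /eqP.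
  have h0 : h = 0.
    have := sum_dot_vertex u; under eq_bigr do rewrite dotC uh.
    by rewrite sumr_const card_ord => /eqP; rewrite mulrn_eq0 => /eqP.
  by rewrite dotC uh h0 /dot mulmx0 mxE.
have d0 j : j != i -> d j = 0.
  move=> ji; apply: contraTeq (introT eqP rank2) => dj.
  apply: (two_tight_vertices_rank ji) => x.
  by rewrite !inE => /or3P[] /eqP->; split; apply: tight;
    by [case: Fa | case: Fb | case: Fc |].
exists i => //; apply/seteqP; split=> x [Px /= Fx]; split=> //=.
  have := sum_d x; rewrite (bigD1 i) //= big1 => [|j /d0->]; last first.
    by rewrite mulr0.
  by rewrite Fx; lra.
exact: tight.
Qed.

(** * Reflections and rotations of a face as permutations *)

Lemma face_in_faces i : face i \in faces (tetrahedron R).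
Proof. by rewrite facesE; apply/mem_set; exists i. Qed.

Definition nth_face i : faces (tetrahedron R) :=
  exist _ (face i) (face_in_faces i).

Lemma nth_face_surj (F : faces (tetrahedron R)) : exists i, F = nth_face i.
Proof.
have [i _ eq_F] : range face (\val F).
  by rewrite -facesE; apply: set_mem (valP F).
by exists i; apply: val_inj.
Qed.

Definition face_index (F : faces (tetrahedron R)) : 'I_4 :=
  projT1 (cid (nth_face_surj F)).

Lemma face_indexK F : nth_face (face_index F) = F.
Proof. exact/esym/(projT2 (cid (nth_face_surj F))). Qed.

Lemma nth_faceK i : face_index (nth_face i) = i.
Proof. by apply: face_inj; have := congr1 val (face_indexK (nth_face i)). Qed.

Lemma square_sum_eq0 (a b : R) : a ^+ 2 + b ^+ 2 = 0 -> a = 0 /\ b = 0.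
Proof.
move/eqP; rewrite paddr_eq0 ?sqr_ge0 // !sqrf_eq0.
by case/andP=> /eqP-> /eqP->.
Qed.

Lemma induced_permutation i (g : face i -> face i) :
    induced_symmetry_group (Td R) (face i) g ->
  exists2 s : 'S_4, s i = i & induces (perm_matrix s) g.
Proof.
case=> A [TdA mvA] indA; rewrite TdE in TdA; case: TdA => s _ defA.
exists s; last by rewrite defA.
by apply: face_inj; rewrite -move_face defA.
Qed.

Definition vertex_in_face i j (ij : i != j) : face i :=
  exist _ (vertex j) (mem_set ((face_vertex i j).2 ij)).

Lemma induces_vertex i (g : face i -> face i) s j (ij : i != j) :
  s i = i -> induces (perm_matrix s) g ->
  exists ij' : i != s j, g (vertex_in_face ij) = vertex_in_face ij'.
Proof.
move=> si ind; have ij' : i != s j by rewrite -{1}si (inj_eq perm_inj).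
by exists ij'; apply: val_inj; rewrite ind /= perm_matrix_vertex.
Qed.

(** A symmetry of a face comes from a single element of the group, since a
    permutation fixing one of the four points is known from the other three. *)
Lemma eq_perm_induced i (g : face i -> face i) s t :
    s i = i -> t i = i -> induces (perm_matrix s) g ->
    induces (perm_matrix t) g ->
  s = t.
Proof.
move=> si ti inds indt; apply/permP=> j.
have [<- | ij] := eqVneq i j; first by rewrite si.
apply: vertex_inj; rewrite -!perm_matrix_vertex.
by have := inds (vertex_in_face ij); rewrite indt.
Qed.

(** A reflection of the face is a nontrivial involution there, hence so is the
    permutation inducing it. *)
Lemma reflection_perm i (g : face i -> face i) s :
    s i = i -> induces (perm_matrix s) g -> is_reflection g ->
  s != 1%g /\ (s * s = 1)%g.
Proof.
move=> si ind [[c [n [n_neq0 gE]]] [x gx]]; split.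
  apply: contra_notN gx => /eqP s1; apply: val_inj.
  by rewrite ind s1 perm_matrix1 mul1mx.
have nn_neq0 : dot n n != 0.
  apply: contra_neq n_neq0; rewrite dotE => nn0; apply/colP=> k; rewrite mxE.
  have sq_ge0 l : true -> 0 <= n l 0 * n l 0 by rewrite -expr2 sqr_ge0.
  move/psumr_eq0P: nn0 => /(_ sq_ge0 k isT)/eqP.
  by rewrite mulf_eq0 orbb => /eqP.
have gg y : val (g (g y)) = val y.
  pose k := 2 * dot (val y - c) n / dot n n; rewrite (gE (g y)) (gE y) -/k.
  have -> : val y - k *: n - c = val y - c - k *: n by rewrite addrAC.
  rewrite dotBl dotZl; set d := dot (val y - c) n.
  have -> : 2 * (d - k * dot n n) / dot n n = - k.
    by rewrite /k -/d; field.
  by rewrite scaleNr opprK subrK.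
apply/permP=> j; rewrite permM perm1.
have [<- | ij] := eqVneq i j; first by rewrite !si.
apply: vertex_inj; have := gg (vertex_in_face ij).
have [ij' ->] := induces_vertex ij si ind.
by have [ij'' ->] := induces_vertex ij' si ind.
Qed.

(** The first two equations are the triple angle formulas at an angle whose
    triple is a full turn. *)
Lemma third_turn (th := 2 * pi / 3 : R) :
  [/\ cos th ^+ 3 - 3 * cos th * sin th ^+ 2 = 1,
      3 * cos th ^+ 2 * sin th - sin th ^+ 3 = 0 & 0 < sin th].
Proof.
have th3 : th + th + th = pi *+ 2 by rewrite /th -mulr_natl; field.
split.
- have := cosD (th + th) th; rewrite th3 cos2pi cosD sinD => e.
  by rewrite [RHS]e; ring.
- have := sinD (th + th) th; rewrite th3 sin2pi cosD sinD => e.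
  by rewrite [RHS]e; ring.
- apply: sin_gt0_pi; have := @pi_gt0 R; rewrite /th => ?.
  by apply/andP; split; lra.
Qed.

(** The coordinates [a], [b] along the orthonormal frame of the rotation turn by
    a third of a full turn, so the third iterate is the identity.  The rotation
    fixes nothing but its centre, so it is not the identity of the face. *)
Lemma rotation_perm i (g : face i -> face i) s :
    s i = i -> induces (perm_matrix s) g -> is_rotation (2 * pi / 3) g ->
  s != 1%g /\ (s * s * s = 1)%g.
Proof.
move=> si ind [c [u [v [uu vv uv gE]]]].
have [] := third_turn.
set C := cos _ in gE *; set S := sin _ in gE * => eqC eqS S_gt0.
have vu : dot v u = 0 by rewrite dotC.
pose a (x : face i) := dot u (val x - c).
pose b (x : face i) := dot v (val x - c).
have coordE (al be : R) : dot u (c + al *: u + be *: v - c) = al /\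
                 dot v (c + al *: u + be *: v - c) = be.
  rewrite -[c + _ + _]addrA [c + _]addrC addrK !dotDr !dotZr uu vv uv vu.
  by split; ring.
have coord (x : face i) : [/\ val x = c + a x *: u + b x *: v,
    a (g x) = a x * C - b x * S & b (g x) = a x * S + b x * C].
  rewrite /a /b; have [al [be [-> ->]]] := gE x.
  by rewrite !(coordE _ _).1 !(coordE _ _).2.
have ggg x : val (g (g (g x))) = val x.
  have [-> _ _] := coord (g (g (g x))).
  have [_ -> ->] := coord (g (g x)); have [_ -> ->] := coord (g x).
  have [-> -> ->] := coord x; congr (_ + _ *: _ + _ *: _).
    (* Three turns combine into the rotation by the triple angle. *)
    rewrite -[RHS]mulr1 -eqC -[RHS]subr0 -(mulr0 (b x)) -eqS; ring.
  rewrite -[RHS]mulr1 -eqC -[RHS]addr0 -(mulr0 (a x)) -eqS; ring.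
split; last first.
  apply/permP=> j; rewrite !permM perm1.
  have [<- | ij] := eqVneq i j; first by rewrite !si.
  apply: vertex_inj; have := ggg (vertex_in_face ij).
  have [ij1 ->] := induces_vertex ij si ind.
  have [ij2 ->] := induces_vertex ij1 si ind.
  by have [ij3 ->] := induces_vertex ij2 si ind.
apply/negP=> /eqP s1.
have all_c (x : face i) : val x = c.
  have gx : g x = x by apply: val_inj; rewrite ind s1 perm_matrix1 mul1mx.
  have [-> ] := coord x; rewrite gx => ea eb.
  (* The cross product of (a, b) with its rotated copy is sin times the square
     of the norm; it vanishes at a fixed point. *)
  have : a x ^+ 2 + b x ^+ 2 = 0.
    have : (a x ^+ 2 + b x ^+ 2) * S = 0.
      have -> : (a x ^+ 2 + b x ^+ 2) * S =
        a x * (a x * S + b x * C) - b x * (a x * C - b x * S) by ring.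
      by rewrite -ea -eb; ring.
    by move/eqP; rewrite mulf_eq0 (gt_eqF S_gt0) orbF => /eqP.
  by case/square_sum_eq0=> -> ->; rewrite !scale0r !addr0.
have [j] : exists j, j \notin [set i]%SET.
  by apply: exists_other; rewrite cards1.
have [k] : exists k, k \notin [set i; j]%SET.
  by apply: exists_other; rewrite cards2; case: (_ != _).
rewrite !inE negb_or => /andP[ki kj] ji.
have vj : vertex j = c.
  by apply: (all_c (@vertex_in_face i j _)); rewrite eq_sym.
have vk : vertex k = c.
  by apply: (all_c (@vertex_in_face i k _)); rewrite eq_sym.
by case/eqP: kj; apply: vertex_inj; rewrite vj vk.
Qed.

(** * Tile designs on the tetrahedron *)

Section Designs.

Variable D : tile_designs (tetrahedron R) (Td R).

Definition design_act s (x : design D * 'I_4) : design D * 'I_4 :=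
  let y := tile_act (perm_matrix s) (x.1, nth_face x.2) in
  (y.1, face_index y.2).

Lemma Td_perm_matrix s : Td R (perm_matrix s).
Proof. by rewrite TdE; exists s. Qed.

Lemma tile_act_face s T i :
  (tile_act (perm_matrix s) (T, nth_face i) : design D * _).2 = nth_face (s i).
Proof.
by apply: val_inj; rewrite /= (tile_act_over (Td_perm_matrix s)) /= move_face.
Qed.

Lemma design_act_over s x : (design_act s x).2 = s x.2.
Proof. by rewrite /= tile_act_face nth_faceK. Qed.

Lemma design_actE s T i : tile_act (perm_matrix s) (T, nth_face i) =
  ((design_act s (T, i)).1, nth_face (s i)).
Proof. by rewrite [LHS]surjective_pairing tile_act_face. Qed.

Lemma design_act1 x : design_act 1 x = x.
Proof.
by case: x => T i; rewrite /design_act perm_matrix1 tile_act1 /= nth_faceK.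
Qed.

Lemma design_actM s t x : design_act (s * t) x = design_act t (design_act s x).
Proof.
case: x => T i.
transitivity (let y := tile_act (perm_matrix t)
                         (tile_act (perm_matrix s) (T, nth_face i)) in
              (y.1, face_index y.2)).
  by rewrite /design_act perm_matrixM tile_actM //; apply: Td_perm_matrix.
by rewrite design_actE -[s i]/(s (T, i).2) -design_act_over.
Qed.

Local Notation act := (tiling_action design_act1 design_actM design_act_over).

Definition tiling_of (tau : {ffun 'I_4 -> design D}) : tiling D :=
  fun F => tau (face_index F).

Lemma tiling_of_inj : injective tiling_of.
Proof.
move=> tau tau' eq_t; apply/ffunP=> i.
have := congr1 (fun f : tiling D => f (nth_face i)) eq_t.
by rewrite /tiling_of nth_faceK.
Qed.

Lemma tiling_of_surj (f : tiling D) : exists tau, f = tiling_of tau.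
Proof.
exists [ffun i => f (nth_face i)]; apply/funext=> F.
by rewrite /tiling_of ffunE face_indexK.
Qed.

(** Moving the graph of a tiling by a matrix of the group is moving the tiling
    by the corresponding permutation of the faces. *)
Lemma tiling_orbit_of tau :
  tiling_orbit (tiling_of tau) =
    tiling_of @` [set` orbit act [set: 'S_4]%SET tau].
Proof.
apply/seteqP; split=> [f [A TdA eq_graph] | _ [tau' /orbitP[s _ <-] <-]].
  rewrite TdE in TdA; case: TdA eq_graph => s _ <- eq_graph.
  have [sigma def_f] := tiling_of_surj f.
  exists sigma => //; apply/orbitP; exists s; rewrite ?inE //.
  apply/esym; apply: (eq_moved_tiling design_act_over) => i.
  have : tiling_graph f (tile_act (perm_matrix s) (tau i, nth_face i)).
    rewrite eq_graph; exists (tau i, nth_face i) => //.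
    by exists (nth_face i) => //; rewrite /tiling_of nth_faceK.
  case=> F _; rewrite design_actE => -[eqT eqF].
  rewrite [RHS]surjective_pairing design_act_over /= -eqT eqF def_f.
  by rewrite /tiling_of nth_faceK.
exists (perm_matrix s); first exact: Td_perm_matrix.
have mv i : ((moved_tiling design_act tau s) (s i), nth_face (s i)) =
    tile_act (perm_matrix s) (tau i, nth_face i).
  by rewrite design_actE -(moved_tilingP design_act_over).
apply/seteqP; split=> [_ [F _ <-] | _ [_ [F _ <-] <-]].
  pose i := (s^-1 (face_index F))%g.
  exists (tau i, nth_face i); last first.
    by rewrite -mv /i permKV /tiling_of face_indexK.
  by exists (nth_face i) => //; rewrite /tiling_of nth_faceK.
rewrite -(face_indexK F) /tiling_of nth_faceK -mv.
by exists (nth_face (s (face_index F))) => //; rewrite nth_faceK.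
Qed.

Lemma card_finset (X : finType) (A : {set X}) : ([set` A] #= `I_#|A|)%card.
Proof.
have -> : [set` A] = @enum_val _ (mem A) @` [set: 'I_#|A|].
  apply/seteqP; split=> [x Ax | _ [k _ <-]]; last exact: enum_valP.
  by exists (enum_rank_in Ax x); rewrite ?enum_rankK_in.
apply: card_eq_trans (inj_card_eq _) _.
  by move=> k l _ _; apply: enum_val_inj.
by rewrite card_eq_sym; apply: card_II.
Qed.

Lemma card_tiling_orbits :
  (tiling_orbits D #=
     `I_#|orbit act [set: 'S_4]%SET @:
          [set: {ffun 'I_4 -> design D}]%SET|)%card.
Proof.
pose im (O : {set {ffun 'I_4 -> design D}}) := tiling_of @` [set` O].
have -> : tiling_orbits D =
    im @` [set` (orbit act [set: 'S_4]%SET @: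
                 [set: {ffun 'I_4 -> design D}]%SET)].
  apply/seteqP; split=> [_ [f _ <-] | _ [_ /imsetP[tau _ ->] <-]].
    have [tau ->] := tiling_of_surj f; exists (orbit act [set: 'S_4]%SET tau).
      by apply/imsetP; exists tau; rewrite ?inE.
    by rewrite tiling_orbit_of.
  by exists (tiling_of tau); rewrite ?tiling_orbit_of.
apply: card_eq_trans (inj_card_eq _) (card_finset _) => O O' _ _ eq_im.
apply/setP=> tau; apply/idP/idP=> Otau.
  have : im O (tiling_of tau) by exists tau.
  by rewrite eq_im => -[tau' ? /tiling_of_inj <-].
have : im O' (tiling_of tau) by exists tau.
by rewrite -eq_im => -[tau' ? /tiling_of_inj <-].
Qed.

Lemma fixed_designsE i (g : face i -> face i) s :
    s i = i -> induces (perm_matrix s) g ->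
  fixed_designs D (F := nth_face i) g = fixed_tiles design_act s i.
Proof.
move=> si ind; apply/setP=> T; rewrite !inE.
have fixE : design_act s (T, i) = (T, i) <->
    tile_act (perm_matrix s) (T, nth_face i) = (T, nth_face i).
  rewrite design_actE si; split=> [-> // | fix_s].
  have eqT : (design_act s (T, i)).1 = T := congr1 fst fix_s.
  by rewrite [LHS]surjective_pairing design_act_over eqT si.
apply/asboolP/eqP=> [[A [[TdA mvA] indA fixA]] | ].
  rewrite TdE in TdA; case: TdA => t _ defA; subst A.
  have ti : t i = i by apply: face_inj; rewrite -move_face.
  by apply/fixE; rewrite (eq_perm_induced si ti ind indA).
move/fixE => fix_s; exists (perm_matrix s); split=> //.
by split; [apply: Td_perm_matrix | rewrite /= move_face si].
Qed.

End Designs.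
End Geometry.

Theorem theorem2 (R : realType)
    (D : tile_designs (tetrahedron R) (Td R))
    (F : faces (tetrahedron R)) (r f : \val F -> \val F)
    (r_sym : induced_symmetry_group (Td R) (\val F) r)
    (r_rot : is_rotation (2 * pi / 3) r)
    (f_sym : induced_symmetry_group (Td R) (\val F) f)
    (f_refl : is_reflection f)
    (t_id t_f t_r : nat)
    (card_id : #|design D| = t_id)
    (card_f : #|fixed_designs D f| = t_f)
    (card_r : #|fixed_designs D r| = t_r) :
  exists n : nat,
    (tiling_orbits D #= `I_n)%card /\
    n%:R = 24%:R^-1 *
      (t_id%:R ^+ 4 + 8%:R * t_id%:R * t_r%:R + 3%:R * t_id%:R ^+ 2
       + 6%:R * t_id%:R * t_f%:R ^+ 2 + 6%:R * t_id%:R) :> rat.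
Proof.
have [i defF] := nth_face_surj F; subst F.
have [s si ind_r] := induced_permutation r_sym.
have [u ui ind_f] := induced_permutation f_sym.
have [s_neq1 s3] := rotation_perm si ind_r r_rot.
have [u_neq1 u2] := reflection_perm ui ind_f f_refl.
eexists; split; first exact: card_tiling_orbits.
have act1 := @design_act1 _ D; have actM := @design_actM _ D.
have := count_tilings act1 actM (@design_act_over _ D).
set n := #|_ @: _|.
have -> : #|fixed_tiles (@design_act _ D) transposition 'o_2| = t_f.
  rewrite -card_f (fixed_designsE _ ui ind_f).
  have [p -> ->] := conj_transposition u_neq1 u2 ui.
  exact/esym/(card_fixed_tilesJ act1 actM (@design_act_over _ D)).
have -> : #|fixed_tiles (@design_act _ D) three_cycle 'o_3| = t_r.
  rewrite -card_r (fixed_designsE _ si ind_r).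
  have [p -> ->] := conj_three_cycle s_neq1 s3 si.
  exact/esym/(card_fixed_tilesJ act1 actM (@design_act_over _ D)).
rewrite card_id => /(congr1 (fun m : nat => m%:R : rat)).
rewrite !natrD !(natrX, natrM) => eq_n.
lra.
Qed.
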